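(* Let $\Delta$ be a finite set of conditional domain constraints (CDCs) over $R$, let $\Pi_\Delta$ be the propositional theory associated with $\Delta$, and let $\Pi_{\text{aux}}$ be the auxiliary theory for $\Pi_\Delta$. Then $\Delta$ is consistent if and only if there exists a valuation $\alpha$ of $\mathsf{var}_{\text p}(\Pi_\Delta)$ that satisfies $\Pi_{\text{aux}}$ and is such that the $\alpha$-filtering $\Pi_\Delta^\alpha$ is satisfiable.
   Context: Setting. $\mathbf{dom}$ is a possibly infinite set of arbitrary values; $\mathbf{idom}$ is a set of values from a specific interpreted domain (e.g. $\mathbb Z$) on which predicates and functions are defined according to a first-order language $\mathfrak C$ (for this result $\mathfrak C$ need not be closed under negation). $R$ is a relation symbol of arity $n$ whose first $k$ positions are non-interpreted (values from $\mathbf{dom}$) and whose remaining $n-k$ positions are interpreted (values from $\mathbf{idom}$). A tuple is an element of $\mathbf{dom}^k\times\mathbf{idom}^{n-k}$; $\overline t[i]$ is its $i$-th element. Variables $\overline x=(x_1,\dots,x_k)$ refer to non-interpreted positions, $\overline y=(y_1,\dots,y_{n-k})$ to interpreted ones ($y_i$ refers to position $k+i$). $\mathfrak C$-formulae have free variables among $\overline y$; a set of $\mathfrak C$-formulae is satisfiable if some assignment $\beta:\{y_1,\dots,y_{n-k}\}\to\mathbf{idom}$ makes all of them true under the semantics of $\mathfrak C$. An instance $I$ over $R$ is a finite set $R^I$ of tuples. CDCs. A CDC is a formula $\forall\overline x,\overline y.\,(R(\overline x,\overline y)\land\lambda(\overline x))\to\delta(\overline y)$, written $\lambda(\overline x)\to\delta(\overline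 y)$, where $\lambda$ is a Boolean combination of equalities $x_i=a$ with $a\in\mathbf{dom}$ (possibly $\top$) and $\delta(\overline y)\in\mathfrak C$. An instance satisfies it if every tuple in $R^I$ whose first $k$ values make $\lambda$ true has its last $n-k$ values making $\delta$ true. A set $\Delta$ of CDCs is consistent if it has a non-empty model, i.e. there is an instance $I$ with $R^I\neq\emptyset$ satisfying all CDCs of $\Delta$. Propositional theory. For $\Delta=\{\phi_1,\dots,\phi_m\}$, with $\phi_i$ being $\lambda_i(\overline x)\to\delta_i(\overline y)$, let $\mathsf{prop}(\phi_i)=P_i\to v_i$, where $P_i$ is obtained from $\lambda_i$ by replacing each equality $x_j=a$ by the propositional variable $p_j^a$, and $v_i$ is a fresh propositional variable associated with the $\mathfrak C$-formula $\mathsf{idf}(v_i)=\delta_i(\overline y)$. $\Pi_\Delta=\{\mathsf{prop}(\phi)\mid\phi\in\Delta\}$, and $\mathsf{var}_{\text p}(\Pi_\Delta)$ is the set of all variables $p_j^a$ occurring in the antecedents $P_i$. The auxiliary theory $\Pi_{\text{aux}}$ for $\Pi_\Delta$ consists of the axioms of unique value $p_j^a\land p_j^b\to\bot$ for all $p_j^a,p_j^b\in\mathsf{var}_{\text p}(\Pi_\Delta)$ with $a\ne b$. A valuation assigns true or false to each propositional variable. The $\alpha$-filtering is $\Pi_\Delta^\alpha=\{\mathsf{idf}(v)\mid(P\to v)\in\Pi_\Delta,\ \alpha(P)=\text{true}\}$.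
   Formalization: The ''if'' direction additionally assumes that at each non-interpreted position some value of dom is not mentioned in the constraints (automatic for infinite dom); without it the claim fails, e.g. dom = {a} and Δ = {x_1 = a → false}. *)

(* Defs.v *)
From mathcomp Require Import all_boot.
From mathcomp Require Import boolp classical_sets functions cardinality.

Set Implicit Arguments.
Unset Strict Implicit.
Unset Printing Implicit Defensive.

Local Open Scope classical_set_scope.

Record signature := Signature {
  fun_sym : Type;
  pred_sym : Type;
  fun_arity : fun_sym -> nat;
  pred_arity : pred_sym -> nat
}.

Inductive term (Sg : signature) (d : nat) : Type :=
| TVar of 'I_d
| TApp (f : fun_sym Sg) of ('I_(fun_arity f) -> term Sg d).

(* The index d bounds the free variables, which are y_1, .., y_d (numbered
   from 0).  Under a quantifier, variable ord0 is the bound one and lift ord0 i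
   is the variable i of the enclosing scope. *)
Inductive formula (Sg : signature) : nat -> Type :=
| FTrue d : formula Sg d
| FFalse d : formula Sg d
| FEq d of term Sg d & term Sg d : formula Sg d
| FPred d (p : pred_sym Sg) of ('I_(pred_arity p) -> term Sg d) : formula Sg d
| FNot d of formula Sg d : formula Sg d
| FAnd d of formula Sg d & formula Sg d : formula Sg d
| FOr d of formula Sg d & formula Sg d : formula Sg d
| FImp d of formula Sg d & formula Sg d : formula Sg d
| FForall d of formula Sg d.+1 : formula Sg d
| FExists d of formula Sg d.+1 : formula Sg d.

Record interpretation (Sg : signature) (idom : Type) := Interpretation {
  interp_fun : forall f : fun_sym Sg, ('I_(fun_arity f) -> idom) -> idom;
  interp_pred : forall p : pred_sym Sg, ('I_(pred_arity p) -> idom) -> Prop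
}.

Section FirstOrderSemantics.
Variables (Sg : signature) (idom : Type) (M : interpretation Sg idom).

Fixpoint eval_term d (beta : 'I_d -> idom) (t : term Sg d) : idom :=
  match t with
  | TVar i => beta i
  | TApp f args => interp_fun M (fun i => eval_term beta (args i))
  end.

Definition extend d (x : idom) (beta : 'I_d -> idom) (i : 'I_d.+1) : idom :=
  if unlift ord0 i is Some j then beta j else x.

Fixpoint sat d (phi : formula Sg d) : ('I_d -> idom) -> Prop :=
  match phi in formula _ d return ('I_d -> idom) -> Prop with
  | FTrue _ => fun _ => True
  | FFalse _ => fun _ => False
  | FEq _ t u => fun beta => eval_term beta t = eval_term beta u
  | FPred _ p args =>
      fun beta => interp_pred M (fun i => eval_term beta (args i))
  | FNot _ f => fun beta => ~ sat f beta
  | FAnd _ f g => fun beta => sat f beta /\ sat g beta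
  | FOr _ f g => fun beta => sat f beta \/ sat g beta
  | FImp _ f g => fun beta => sat f beta -> sat g beta
  | FForall _ f => fun beta => forall x, sat f (extend x beta)
  | FExists _ f => fun beta => exists x, sat f (extend x beta)
  end.

Definition satisfiable d (Gamma : set (formula Sg d)) : Prop :=
  exists beta : 'I_d -> idom, forall phi, Gamma phi -> sat phi beta.

End FirstOrderSemantics.

Inductive bform (A : Type) : Type :=
| BTop
| BBot
| BAtom of A
| BNot of bform A
| BAnd of bform A & bform A
| BOr of bform A & bform A
| BImp of bform A & bform A.
Arguments BTop {A}.
Arguments BBot {A}.

Fixpoint beval A (nu : A -> bool) (f : bform A) : bool :=
  match f with
  | BTop => true
  | BBot => false
  | BAtom a => nu a
  | BNot g => ~~ beval nu g
  | BAnd g h => beval nu g && beval nu h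
  | BOr g h => beval nu g || beval nu h
  | BImp g h => beval nu g ==> beval nu h
  end.

Fixpoint bmap A B (s : A -> B) (f : bform A) : bform B :=
  match f with
  | BTop => BTop
  | BBot => BBot
  | BAtom a => BAtom (s a)
  | BNot g => BNot (bmap s g)
  | BAnd g h => BAnd (bmap s g) (bmap s h)
  | BOr g h => BOr (bmap s g) (bmap s h)
  | BImp g h => BImp (bmap s g) (bmap s h)
  end.

Fixpoint atoms A (f : bform A) : set A :=
  match f with
  | BTop | BBot => set0
  | BAtom a => [set a]
  | BNot g => atoms g
  | BAnd g h | BOr g h | BImp g h => atoms g `|` atoms h
  end.

(* XEq j a is the equality x_j = a between a non-interpreted variable and a
   constant; PVar j a is the propositional variable p_j^a standing for it. *)
Inductive xeq (dom : Type) (k : nat) := XEq of 'I_k & dom.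
Inductive pvar (dom : Type) (k : nat) := PVar of 'I_k & dom.

Definition xeq_true (dom : Type) (k : nat) (t : k.-tuple dom)
    (e : xeq dom k) : bool :=
  let: XEq j a := e in `[< tnth t j = a >].

Definition pvar_of_xeq (dom : Type) (k : nat) (e : xeq dom k) : pvar dom k :=
  let: XEq j a := e in PVar j a.

(* C is the set of formulae of the constraint language: an arbitrary fragment
   of first-order logic, in particular not assumed closed under negation. *)
Record cdc (dom : Type) (Sg : signature) (k d : nat)
    (C : set (formula Sg d)) := CDC {
  cdc_ante : bform (xeq dom k);
  cdc_cons : formula Sg d;
  cdc_consP : C cdc_cons
}.

Definition rtuple (dom idom : Type) (k d : nat) : Type :=
  (k.-tuple dom * d.-tuple idom)%type.

Record instance (dom idom : Type) (k d : nat) := Instance {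
  inst_rel : set (rtuple dom idom k d);
  inst_finite : finite_set inst_rel
}.

Section CDCs.
Variables (dom idom : Type) (Sg : signature) (M : interpretation Sg idom).
Variables (k d : nat) (C : set (formula Sg d)).

Definition satisfies (I : instance dom idom k d) (phi : cdc dom k C) : Prop :=
  forall t, inst_rel I t ->
    beval (xeq_true t.1) (cdc_ante phi) -> sat M (cdc_cons phi) (tnth t.2).

Definition consistent m (Delta : m.-tuple (cdc dom k C)) : Prop :=
  exists I : instance dom idom k d,
    inst_rel I !=set0 /\ forall i, satisfies I (tnth Delta i).

End CDCs.

(* The pair (P, v) is the implication P -> v.  The variables v_1, .., v_m are
   the elements of 'I_m, so they are fresh by typing, and pairwise distinct. *)
Definition clause (dom : Type) (k m : nat) : Type :=
  (bform (pvar dom k) * 'I_m)%type.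

Section PropositionalTheory.
Variables (dom : Type) (Sg : signature) (k d : nat) (C : set (formula Sg d)).
Variables (m : nat) (Delta : m.-tuple (cdc dom k C)).

Definition idf (v : 'I_m) : formula Sg d := cdc_cons (tnth Delta v).

Definition prop_cdc (i : 'I_m) : clause dom k m :=
  (bmap (@pvar_of_xeq dom k) (cdc_ante (tnth Delta i)), i).

Definition prop_theory : set (clause dom k m) := range prop_cdc.

Definition varp : set (pvar dom k) :=
  \bigcup_(c in prop_theory) atoms c.1.

Definition aux_theory : set (bform (pvar dom k)) :=
  [set f | exists (j : 'I_k) (a b : dom),
     [/\ varp (PVar j a), varp (PVar j b), a <> b &
         f = BImp (BAnd (BAtom (PVar j a)) (BAtom (PVar j b))) BBot]].

Definition satisfies_theory (alpha : pvar dom k -> bool)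
    (T : set (bform (pvar dom k))) : Prop :=
  forall f, T f -> beval alpha f.

Definition filtering (alpha : pvar dom k -> bool) : set (formula Sg d) :=
  [set idf c.2 | c in [set c | prop_theory c /\ beval alpha c.1]].

(* At each non-interpreted position some element of dom is not mentioned.  This
   cannot be dropped from the construction of a model out of a valuation: if
   dom = {a} and the only constraint is x_1 = a -> false, making p_1^a false
   leaves nothing to satisfy, yet no tuple satisfies the constraint. *)
Definition unmentioned_values : Prop :=
  forall j : 'I_k, exists a : dom, ~ varp (PVar j a).

Lemma infinite_unmentioned_values :
  infinite_set [set: dom] -> unmentioned_values.
Proof.
move=> infD j; apply: contrapT => noa; apply: infD.
have fin_atoms (A : Type) (f : bform A) : finite_set (atoms f).
  by elim: f => //= *; rewrite ?finite_setU //; apply: finite_set1.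
have fin_var : finite_set varp.
  apply: bigcup_finite => [|c _]; last exact: fin_atoms.
  exact: finite_image.
apply: (@sub_finite_set _ _ ((fun p : pvar dom k => let: PVar _ a := p in a) @` varp));
  last exact: finite_image.
move=> a _; exists (PVar j a) => //.
by apply: contrapT => na; apply: noa; exists a.
Qed.

End PropositionalTheory.

(* Main.v *)
(* A tuple x induces the valuation p_j^a := (x_j = a), which satisfies the
   unique-value axioms.  Conversely, under these axioms a valuation makes at
   most one mentioned p_j^a true for each j: taking x_j to be that a, or an
   unmentioned value if there is none, gives a tuple whose valuation agrees on
   the mentioned variables, hence makes the same antecedents true.  One tuple
   is enough for a model, since each constraint speaks about one tuple. *)

Require Import Defs.
From mathcomp Require Import all_boot.
From mathcomp Require Import boolp classical_sets functions cardinality.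

Set Implicit Arguments.
Unset Strict Implicit.

Local Open Scope classical_set_scope.

Lemma beval_bmap (A B : Type) (s : A -> B) (nu : B -> bool) (f : bform A) :
  beval nu (bmap s f) = beval (nu \o s) f.
Proof. by elim: f => //= [g ->|g -> h ->|g -> h ->|g -> h ->]. Qed.

Lemma eq_beval (A : Type) (nu nu' : A -> bool) (f : bform A) :
  {in atoms f, nu =1 nu'} -> beval nu f = beval nu' f.
Proof.
elim: f => //= [a eqa|g IHg eqg|g IHg h IHh eqgh|g IHg h IHh eqgh|
                g IHg h IHh eqgh].
- by apply: eqa; rewrite inE.
- by rewrite IHg.
all: by rewrite IHg ?IHh // => a; rewrite inE => ?; apply: eqgh;
  rewrite inE; [right|left].
Qed.

Definition tuple_valuation (dom : Type) (k : nat) (x : k.-tuple dom)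
    (p : pvar dom k) : bool :=
  let: PVar j a := p in `[< tnth x j = a >].

Section Valuations.
Variables (dom idom : Type) (Sg : signature) (M : interpretation Sg idom).
Variables (k d : nat) (C : set (formula Sg d)).
Variables (m : nat) (Delta : m.-tuple (cdc dom k C)).

(** Every atom of a translated antecedent lies in [varp Delta], so agreement there suffices to
    evaluate it. *)
Lemma beval_prop_cdc (alpha : pvar dom k -> bool) (x : k.-tuple dom)
    (i : 'I_m) :
  {in varp Delta, alpha =1 tuple_valuation x} ->
  beval alpha (prop_cdc Delta i).1 =
  beval (xeq_true x) (cdc_ante (tnth Delta i)).
Proof.
move=> eq_alpha; rewrite (@eq_beval _ _ (tuple_valuation x)).
  by rewrite beval_bmap; apply: eq_beval => -[].
move=> p; rewrite inE => ip; apply: eq_alpha; rewrite inE.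
by exists (prop_cdc Delta i) => //; exists i.
Qed.

Lemma tuple_valuation_aux (x : k.-tuple dom) :
  satisfies_theory (tuple_valuation x) (aux_theory Delta).
Proof.
move=> _ [j [a [b [_ _ neq_ab ->]]]] /=.
by apply/implyP => /andP[/asboolP xa /asboolP xb]; case: neq_ab; rewrite -xa.
Qed.

Lemma exists_tuple_valuation (alpha : pvar dom k -> bool) :
  unmentioned_values Delta -> satisfies_theory alpha (aux_theory Delta) ->
  exists x : k.-tuple dom, {in varp Delta, alpha =1 tuple_valuation x}.
Proof.
move=> unmentioned alpha_aux.
(* The positions are independent: each coordinate is found on its own and [choice] assembles
   them. *)
have /choice[x xP] (j : 'I_k) : exists a, forall b,
    varp Delta (PVar j b) -> alpha (PVar j b) = `[< a = b >].
  have [[a [ja alpha_a]]|no_a] :=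
      pselect (exists a, varp Delta (PVar j a) /\ alpha (PVar j a)).
    exists a => b jb; apply/idP/asboolP => [alpha_b|<- //].
    (* Two true mentioned variables at [j] with distinct values would violate a unique-value
       axiom. *)
    apply: contrapT => neq_ab.
    have /alpha_aux : aux_theory Delta
        (BImp (BAnd (BAtom (PVar j a)) (BAtom (PVar j b))) BBot).
      by exists j, a, b.
    by rewrite /= alpha_a alpha_b.
  (* No mentioned variable at [j] is true, and an unmentioned [a] differs from every mentioned [b]:
     both sides are false. *)
  have [a not_ja] := unmentioned j.
  exists a => b jb; apply/idP/asboolP => [alpha_b|eq_ab].
    by case: no_a; exists b.
  by case: not_ja; rewrite eq_ab.
by exists (mktuple x) => -[j b]; rewrite inE => /xP /= ->; rewrite tnth_mktuple.
Qed.

(** A formula enters the filtering exactly through an index whose antecedent holds at [t.1], by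
    [beval_prop_cdc]. Both directions of the theorem rest on this: one takes [alpha] from a given
    tuple, the other builds the tuple from [alpha]. *)
Lemma filtering_satP (alpha : pvar dom k -> bool) (t : rtuple dom idom k d) :
  {in varp Delta, alpha =1 tuple_valuation t.1} ->
  (forall phi, filtering Delta alpha phi -> sat M phi (tnth t.2)) <->
  (forall i, beval (xeq_true t.1) (cdc_ante (tnth Delta i)) ->
     sat M (cdc_cons (tnth Delta i)) (tnth t.2)).
Proof.
move=> eq_alpha; split=> [satF i|sat_t _ [_ [[i _ <-] alpha_i] <-]].
  rewrite -(beval_prop_cdc i eq_alpha) => alpha_i; apply: satF.
  by exists (prop_cdc Delta i) => //; split=> //; exists i.
by apply: sat_t; rewrite -(beval_prop_cdc i eq_alpha).
Qed.

End Valuations.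

Unset Implicit Arguments.
Set Strict Implicit.

Theorem theorem1 (dom idom : Type) (Sg : signature)
    (M : interpretation Sg idom) (n k : nat) (le_kn : k <= n)
    (C : set (formula Sg (n - k)))
    (m : nat) (Delta : m.-tuple (cdc dom k C)) :
  (consistent M Delta ->
   exists alpha : pvar dom k -> bool,
     satisfies_theory alpha (aux_theory Delta) /\
     satisfiable M (filtering Delta alpha)) /\
  (unmentioned_values Delta ->
   (exists alpha : pvar dom k -> bool,
      satisfies_theory alpha (aux_theory Delta) /\
      satisfiable M (filtering Delta alpha)) ->
   consistent M Delta).
Proof.
split=> [[I [[t It] I_sat]]|unmentioned [alpha [alpha_aux [beta beta_sat]]]].
  exists (tuple_valuation t.1); split; first exact: tuple_valuation_aux.
  exists (tnth t.2); apply/filtering_satP => // i.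
  exact: I_sat.
have [x eq_alpha] := exists_tuple_valuation unmentioned alpha_aux.
exists (Instance (finite_set1 (x, mktuple beta))).
split=> [|i t /= ->]; first by exists (x, mktuple beta).
move: i; apply/(filtering_satP M (t := (x, mktuple beta)) eq_alpha) => phi /beta_sat.
(* The tuple storing [beta] gives it back only pointwise, hence [funext]. *)
by congr (sat M phi _); apply/funext => j; rewrite tnth_mktuple.
Qed.
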